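(* Let $f:\mathbb{R}^d\to\mathbb{R}$ and let $\Pi$ be the probability distribution on $\mathbb{R}^d$ with Lebesgue density $\pi(\theta) = Z_\Pi^{-1}\exp(-f(\theta))$, where $Z_\Pi$ is the normalizing constant. Let $\alpha\in(0,+\infty)$ and let $C\in\mathbb{R}^{d\times d}$ be a symmetric positive-definite matrix. Suppose that the function $\theta\mapsto f(\theta)-\alpha\theta^T C^{-1}\theta/2$ is convex on $\mathbb{R}^d$. Let $\theta_0\in\mathbb{R}^d$ and let $g_{f(\theta_0)}\in\mathbb{R}^d$ be a subgradient of $f$ at $\theta_0$. Let $P$ be the Metropolis-Hastings independence kernel (see context) with target $\Pi$ and Gaussian proposal $Q=\mathrm{N}_d(\theta_0-\alpha^{-1}C g_{f(\theta_0)},\alpha^{-1}C)$, and let $$\epsilon_{\theta_0} = (2\pi)^{-d/2}\det(\alpha^{-1}C)^{-1/2} Z_\Pi\exp\left(f(\theta_0)-\frac{1}{2\alpha}\,g_{f(\theta_0)}^T\, C\, g_{f(\theta_0)}\right),$$ where the $\pi$ in $(2\pi)^{-d/2}$ is the numerical constant. Then for every lower semicontinuous metric $\rho$ on $\mathbb{R}^d$ and every integer $t\ge1$, $$\mathcal{W}_\rho\left(P^t(\theta_0,\cdot),\Pi\right) = (1-\epsilon_{\theta_0})^t\int\rho(\theta,\theta_0)\,d\Pi(\theta).$$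
   Context: Metropolis-Hastings independence (MHI) kernel on $\mathbb{R}^d$ with strictly positive target density $\pi$ and strictly positive proposal density $q$, where the proposal distribution $Q$ is assumed different from $\Pi$: let $a(\theta,\theta') = \min\left\{ \frac{\pi(\theta') q(\theta)}{\pi(\theta) q(\theta')}, 1\right\}$ and for measurable $B\subseteq\mathbb{R}^d$ $$P(\theta, B) = \int_B a(\theta,\theta') q(\theta')\, d\theta' + \delta_\theta(B)\left(1 - \int a(\theta,\theta') q(\theta')\, d\theta'\right),$$ where $\delta_\theta$ is the Dirac measure at $\theta$; $P^1=P$ and $P^t(\theta,B) = \int P(\theta,d\theta')P^{t-1}(\theta',B)$ for $t\ge 2$. Wasserstein distance: for a lower semicontinuous metric $\rho$ on $\mathbb{R}^d$ (lower semicontinuous on $\mathbb{R}^d\times\mathbb{R}^d$ with the Euclidean topology), $\mathcal{W}_\rho(\mu,\nu) = \inf_{\xi\in\mathcal{C}(\mu,\nu)}\int\rho\,d\xi$, where $\mathcal{C}(\mu,\nu)$ is the set of joint probability measures with marginals $\mu$ and $\nu$. Values in $[0,+\infty]$ are allowed. *)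

(* Defs.v *)
From HB Require Import structures.
From mathcomp Require Import all_boot all_order all_algebra.
From mathcomp Require Import ring lra.
From mathcomp Require Import all_classical all_reals all_analysis.
Set Implicit Arguments.
Unset Strict Implicit.
Unset Printing Implicit Defensive.
Import Order.TTheory GRing.Theory Num.Theory.
Import numFieldNormedType.Exports.
Local Open Scope classical_set_scope.
Local Open Scope ring_scope.

Definition measure_matrix_display : measure_display.
Proof. exact: default_measure_display. Qed.

(* Borel sigma-algebra of the product topology on matrices, in particular the
   Euclidean Borel sigma-algebra on R^d = 'cV[R]_d. *)
Section borel_matrix.
Context {R : realType} {m n : nat}.

Let matrix_set0 : <<s @open 'M[R]_(m, n) >> set0.
Proof. exact: sigma_algebra0. Qed.

Let matrix_setC A :
  <<s @open 'M[R]_(m, n) >> A -> <<s @open 'M[R]_(m, n) >> (~` A).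
Proof. exact: sigma_algebraC. Qed.

Let matrix_bigcup (F : (set 'M[R]_(m, n))^nat) :
  (forall i, <<s @open 'M[R]_(m, n) >> (F i)) ->
  <<s @open 'M[R]_(m, n) >> (\bigcup_i (F i)).
Proof. exact: sigma_algebra_bigcup. Qed.

HB.instance Definition _ := @isMeasurable.Build measure_matrix_display
  'M[R]_(m, n) <<s @open 'M[R]_(m, n) >> matrix_set0 matrix_setC matrix_bigcup.

Let box (q : 'M[rat]_(m, n)) (k : nat) : set 'M[R]_(m, n) :=
  [set M | forall i j, ball (ratr (q i j) : R) k.+1%:R^-1 (M i j)].

Let open_box (A : set 'M[R]_(m, n)) : open A ->
  A = \bigcup_(p in [set p : 'M[rat]_(m, n) * nat | box p.1 p.2 `<=` A])
        box p.1 p.2.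
Proof.
move=> oA; apply/seteqP; split => [M AM|M [p /= pA]]; last exact: pA.
have /nbhs_ballP[e /= e0 eA] : nbhs M A by exact: open_nbhs_nbhs.
have [k _ /(_ k (leqnn k)) ke] :
    \forall k \near \oo, (k.+1%:R^-1 : R) < e / 2.
  by near=> k; near: k; apply: near_infty_natSinv_lt (PosNum (divr_gt0 e0 _)).
have k0 : (0 : R) < k.+1%:R^-1 by rewrite invr_gt0.
have rq (x : R) : exists q : rat, ball (ratr q : R) k.+1%:R^-1 x.
  have /rat_in_itvoo[q] : x - k.+1%:R^-1 < x + k.+1%:R^-1.
    by rewrite ltrD2l (lt_trans _ k0)// oppr_lt0.
  rewrite in_itv/= => /andP[h1 h2]; exists q.
  by move: h1 h2; rewrite /ball/= ltr_distlC; move: (_^-1) => e1 h1 h2; apply/andP; split; lra.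
have [q qM] := choice (fun ij : 'I_m * 'I_n => rq (M ij.1 ij.2)).
pose Q : 'M[rat]_(m, n) := \matrix_(i, j) q (i, j).
have bM : box Q k M by move=> i j; rewrite mxE; exact: (qM (i, j)).
exists (Q, k) => //= N bN; apply: eA; split => // i j.
have := bM i j; have := bN i j.
rewrite /ball/= => h1 h2.
have := ler_distD (ratr (Q i j)) (M i j) (N i j).
move=> /le_lt_trans; apply.
rewrite (splitr e) ltrD//; last exact: lt_trans h1 ke.
by rewrite distrC (lt_trans h2).
Unshelve. all: by end_near.
Qed.

Lemma measurable_fun_matrixP d (T : measurableType d) (f : T -> 'M[R]_(m, n)) :
  measurable_fun [set: T] f <->
  forall i j, measurable_fun [set: T] (fun x => f x i j : R).
Proof.
split => [mf i j|mf].
  have -> : (fun x => f x i j) = (fun M : 'M[R]_(m, n) => M i j) \o f by [].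
  apply: measurableT_comp mf.
  apply: (measurability _ (measurable_realfun.RGenOpens.measurableE R)) => _ [_ [a [b ->] <-]].
  rewrite setTI; apply: sub_sigma_algebra.
  by move: (@coord_continuous R m n i j) => /continuousP; apply; exact: itv_open.
apply: (measurability (@open 'M[R]_(m, n))) => // _ [A oA <-].
rewrite setTI (open_box oA) preimage_bigcup bigcup_mkcond.
apply: countable_bigcupT_measurable => [|p]; first exact: countableP.
case: ifP => // _.
have -> : f @^-1` box p.1 p.2 = \bigcap_i \bigcap_j
    ((fun x => f x i j) @^-1` ball (ratr (p.1 i j) : R) p.2.+1%:R^-1).
  by apply/seteqP; split => [x /= h i _ j _|x /= h i j]; exact: h.
do 2 (apply: fin_bigcap_measurable => // ? _).
by rewrite -[X in measurable X]setTI; apply: mf => //; rewrite ball_itv; exact: measurable_itv.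
Qed.

End borel_matrix.

(* The Lebesgue measure on R^(n+1) is the image of the product of the Lebesgue
   measures on R and R^n by (x, v) |-> (x, v_0, .., v_(n-1)). *)
Section lebesgue_step.
Context {R : realType} {n : nat}.

Definition cons_col (p : R * 'cV[R]_n) : 'cV[R]_n.+1 :=
  col_mx (p.1%:M : 'cV_1) p.2.

Lemma measurable_cons_col : measurable_fun [set: R * 'cV[R]_n] cons_col.
Proof.
apply/measurable_fun_matrixP => i j.
rewrite (_ : (fun x => _) = (fun p : R * 'cV[R]_n =>
    if fintype.split (i : 'I_(1 + n)) is inr k then p.2 k j else p.1)); last first.
  apply/funext => p; rewrite mxE; case: fintype.split => // k.
  by rewrite !mxE !ord1 eqxx mulr1n.
case: fintype.split => k; first exact: measurable_fst.
exact: ((measurable_fun_matrixP (@snd R 'cV[R]_n)).1 measurable_snd k j).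
Qed.

Variable mu : {sigma_finite_measure set 'cV[R]_n -> \bar R}.

Definition lebesgue_cons : set 'cV[R]_n.+1 -> \bar R :=
  pushforward (lebesgue_measure \x mu)%E cons_col.

Let lebesgue_cons0 : lebesgue_cons set0 = 0%E.
Proof. by rewrite /lebesgue_cons /pushforward preimage_set0 measure0. Qed.

Let lebesgue_cons_ge0 A : (0 <= lebesgue_cons A)%E.
Proof. exact: (measure_ge0 (lebesgue_measure \x mu)%E). Qed.

Let lebesgue_cons_sigma_additive : semi_sigma_additive lebesgue_cons.
Proof.
have mf := measurable_cons_col.
exact: measure_semi_sigma_additive.
Qed.

HB.instance Definition _ := isMeasure.Build _ _ _ lebesgue_cons
  lebesgue_cons0 lebesgue_cons_ge0 lebesgue_cons_sigma_additive.

Let lebesgue_cons_sigma_finite : sigma_finite setT lebesgue_cons.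
Proof.
have /sigma_finiteP[F [FT ndF Foo]] := sigma_finiteT (@lebesgue_measure R).
have /sigma_finiteP[G [GT ndG Goo]] := sigma_finiteT mu.
pose h (v : 'cV[R]_n.+1) : R * 'cV[R]_n :=
  (v 0 0, dsubmx (v : 'cV[R]_(1 + n))).
have mh : measurable_fun setT h.
  have mid := (measurable_fun_matrixP _).1 (@measurable_id _ 'cV[R]_n.+1 setT).
  apply/measurable_fun_pairP; split; first exact: mid.
  apply/measurable_fun_matrixP => i j.
  by under eq_fun do rewrite /h/= mxE; exact: mid.
have hK p : h (cons_col p) = p.
  case: p => x v; congr pair; last by rewrite col_mxKd.
  have := col_mxEu (x%:M : 'cV_1) v 0 0; rewrite [RHS]mxE eqxx mulr1n.
  by have -> : lshift n (0 : 'I_1) = (0 : 'I_n.+1) by exact/val_inj.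
exists (fun k => h @^-1` (F k `*` G k)).
  apply/seteqP; split => // v _.
  have [k1 _ Fk1] : (\bigcup_k F k) (h v).1 by rewrite -FT.
  have [k2 _ Gk2] : (\bigcup_k G k) (h v).2 by rewrite -GT.
  exists (maxn k1 k2) => //; split.
    by move: Fk1; exact/subsetPset/ndF/leq_maxl.
  by move: Gk2; exact/subsetPset/ndG/leq_maxr.
move=> k; have [mF Fk] := Foo k; have [mG Gk] := Goo k; split.
  by rewrite -[X in measurable X]setTI; apply: mh => //; exact: measurableX.
rewrite /lebesgue_cons /pushforward -comp_preimage.
rewrite (_ : h \o cons_col = id); last exact/funext.
by rewrite preimage_id product_measure1E// lte_mul_pinfty// ge0_fin_numE.
Qed.

HB.instance Definition _ := Measure_isSigmaFinite.Build _ _ _ lebesgue_cons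
  lebesgue_cons_sigma_finite.

End lebesgue_step.

Fixpoint lebesgue_cV {R : realType} (n : nat) :
    {sigma_finite_measure set 'cV[R]_n -> \bar R} :=
  if n is n'.+1 then lebesgue_cons (lebesgue_cV n') else \d_(0 : 'cV[R]_0).

Lemma lebesgue_cV_box (R : realType) n (A : 'I_n -> set R) :
  (forall i, measurable (A i)) ->
  lebesgue_cV n [set v | forall i, A i (v i 0)] =
  (\prod_(i < n) lebesgue_measure (A i))%E.
Proof.
elim: n A => [|n IH] A mA.
  rewrite big_ord0 /= diracE mem_set// => -[].
  by case.
rewrite big_ord_recl -IH//= /lebesgue_cons /pushforward.
rewrite -product_measure1E; [|exact: mA|]; last first.
  suff -> : (fun v : 'cV[R]_n => forall i, A (lift ord0 i) (v i 0)) =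
      \bigcap_i ((fun v : 'cV[R]_n => v i 0) @^-1` A (lift ord0 i)).
    apply: fin_bigcap_measurable => // i _; rewrite -[X in measurable X]setTI.
    have mid := (measurable_fun_matrixP _).1 (@measurable_id _ 'cV[R]_n setT).
    exact: mid.
  by apply/seteqP; split => [v h i _|v h i]; [exact: h|exact: (h i)].
congr (_ \x _)%E; apply/seteqP; split => -[x v] /=.
- move=> h; split => [|i].
    have := h ord0; rewrite /cons_col.
    have -> : ord0 = lshift n (0 : 'I_1) :> 'I_n.+1 by exact/val_inj.
    by rewrite (col_mxEu (x%:M : 'cV_1)) mxE eqxx mulr1n.
  have := h (lift ord0 i); rewrite /cons_col.
  have -> : lift ord0 i = rshift 1 i by exact/val_inj.
  by rewrite (col_mxEd (x%:M : 'cV_1)).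
- move=> [h0 h] i; rewrite /cons_col /=.
  have [j ->|->] := unliftP ord0 i.
    have := h j; have -> : lift ord0 j = rshift 1 j by exact/val_inj.
    by rewrite (col_mxEd (x%:M : 'cV_1)).
  move: h0; have -> : ord0 = lshift n (0 : 'I_1) :> 'I_n.+1 by exact/val_inj.
  by rewrite (col_mxEu (x%:M : 'cV_1)) mxE eqxx mulr1n.
Qed.

Section transport.
Context {d : measure_display} {T : measurableType d} {R : realType}.
Local Open Scope ereal_scope.

Definition is_metric (rho : T -> T -> R) : Prop :=
  [/\ forall x y, (0 <= rho x y)%R,
      forall x y, rho x y = 0%R <-> x = y,
      forall x y, rho x y = rho y x &
      forall x y z, (rho x z <= rho x y + rho y z)%R].

Definition couplings (mu nu : set T -> \bar R) :
    set (probability (T * T)%type R) :=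
  [set xi | forall B, measurable B ->
     xi (B `*` setT) = mu B /\ xi (setT `*` B) = nu B].

Definition wasserstein (rho : T -> T -> R) (mu nu : set T -> \bar R) : \bar R :=
  ereal_inf [set \int[xi]_p (rho p.1 p.2)%:E | xi in couplings mu nu].

(* For t >= 1 this is the usual recursion started at P^1 = P. *)
Fixpoint kernel_iter (P : T -> set T -> \bar R) (t : nat) : T -> set T -> \bar R :=
  match t with
  | 0 => fun x B => \d_x B
  | 1 => P
  | t'.+1 => fun x B => \int[P x]_y kernel_iter P t' y B
  end.

End transport.

Section mhi.
Context {R : realType} {d : nat}.
Implicit Types (p q f : 'cV[R]_d -> R) (x y : 'cV[R]_d).

(* Only the values on measurable sets are meaningful. *)
Definition density_measure p (B : set 'cV[R]_d) : \bar R :=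
  (\int[lebesgue_cV d]_(x in B) (p x)%:E)%E.

Definition mhi_accept p q x y : R := Num.min ((p y * q x) / (p x * q y)) 1.

Definition mhi_kernel p q x (B : set 'cV[R]_d) : \bar R :=
  (\int[lebesgue_cV d]_(y in B) (mhi_accept p q x y * q y)%:E
   + \d_x B * (1 - \int[lebesgue_cV d]_y (mhi_accept p q x y * q y)%:E))%E.

Definition quad_form (A : 'M[R]_d) x : R := (x^T *m A *m x) 0 0.

Definition sym_posdef (A : 'M[R]_d) : Prop :=
  A^T = A /\ forall x, x != 0 -> 0 < quad_form A x.

Definition is_subgradient f x (g : 'cV[R]_d) : Prop :=
  forall y, f x + (g^T *m (y - x)) 0 0 <= f y.

(* The real-valued integral is 0 when the integral of exp(-f) is infinite; it is
   the normalizing constant when that integral is finite, as it is for f strongly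
   convex. *)
Definition gibbs_const f : R := \int[lebesgue_cV d]_x expR (- f x).

Definition gibbs_density f x : R := (gibbs_const f)^-1 * expR (- f x).

Definition normal_density (m : 'cV[R]_d) (S : 'M[R]_d) x : R :=
  (2 * pi) `^ (- (d%:R / 2)) * \det S `^ (- (1 / 2))
  * expR (- (quad_form (invmx S) (x - m) / 2)).

End mhi.

(* Main.v *)
(* Strong convexity and the subgradient inequality give
     f y >= f th0 + g . (y - th0) + (alpha / 2) (y - th0)^T C^-1 (y - th0),
   and completing the square turns this into eps * target <= proposal with
   equality at th0: the proposal is centred exactly so that th0 minimizes
   proposal / target.  Hence every move proposed from th0 is accepted with
   density eps * target, that is P(th0, .) = eps Pi + (1 - eps) delta_th0.
   Since Pi is invariant by detailed balance, iterating gives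
     P^t(th0, .) = (1 - l) Pi + l delta_th0   with   l = (1 - eps)^t.
   The coupling (1 - l) (id, id)_* Pi + l (delta_th0 x Pi) has cost
   l * int rho(., th0) dPi.  Conversely the functions min(rho(., th0), n) are
   1-Lipschitz for rho, bounded, and vanish at th0, so every coupling costs at
   least l * int min(rho(., th0), n) dPi; let n go to infinity. *)
Require Import Defs.
From HB Require Import structures.
From mathcomp Require Import all_boot all_order all_algebra.
From mathcomp Require Import ring lra.
From mathcomp Require Import all_classical all_reals all_analysis.
From mathcomp Require Import measurable_realfun.
Set Implicit Arguments.
Unset Strict Implicit.
Unset Printing Implicit Defensive.
Import Order.TTheory GRing.Theory Num.Theory.
Import numFieldNormedType.Exports.
Local Open Scope classical_set_scope.
Local Open Scope ring_scope.

(** * Measures with a density *)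

Section density.
Context {d : measure_display} {T : measurableType d} {R : realType}.
Variables (mu : {measure set T -> \bar R}) (g : T -> R).
Hypotheses (mg : measurable_fun setT g) (g0 : forall x, 0 <= g x).
Local Open Scope ereal_scope.

Lemma density_is_measure :
  exists nu : {measure set T -> \bar R}, forall A, nu A = \int[mu]_(x in A) (g x)%:E.
Proof.
pose D A := \int[mu]_(x in A) (g x)%:E.
have D0 : D set0 = 0 by rewrite /D integral_set0.
have Dge0 A : 0 <= D A by apply: integral_ge0 => x _; rewrite lee_fin.
have Dsa : semi_sigma_additive D.
  move=> F mF tF mUF; rewrite /D ge0_integral_bigcup//; last 2 first.
  - by apply: measurable_funTS; exact/measurable_EFinP.
  - by move=> x _; rewrite lee_fin.
  by apply: is_cvg_ereal_nneg_natsum_cond => n _ _; exact: Dge0.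
pose nu : {measure set T -> \bar R} :=
  HB.pack D (isMeasure.Build _ _ _ D D0 Dge0 Dsa).
by exists nu.
Qed.

Import HBNNSimple.

Lemma ge0_integral_density (h : T -> \bar R) :
  measurable_fun setT h -> (forall x, 0 <= h x) ->
  \int[fun A => \int[mu]_(x in A) (g x)%:E]_x h x = \int[mu]_x ((g x)%:E * h x).
Proof.
move=> mh h0; have [nu nuE] := density_is_measure.
rewrite (_ : (fun A => _) = nu); last by apply/funext => A; rewrite nuE.
pose h_ := nnsfun_approx measurableT mh.
have nd_h x : {homo (fun n => h_ n x) : a b / (a <= b)%N >-> (a <= b)%R}.
  by move=> a b ab; exact/lefP/nd_nnsfun_approx.
have hE x : h x = limn (fun n => (h_ n x)%:E).
  by apply/esym/cvg_lim => //; exact: cvg_nnsfun_approx.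
have ghE x : (g x)%:E * h x = limn (fun n => (g x)%:E * (h_ n x)%:E).
  apply/esym/cvg_lim => //; apply: cvgeZl => //.
  exact: cvg_nnsfun_approx.
have mE := (measurable_EFinP setT g).2 mg.
transitivity (limn (fun n => \int[nu]_x (h_ n x)%:E)).
  under eq_integral do rewrite hE.
  apply: monotone_convergence => //.
  - by move=> n; exact/measurable_EFinP.
  - by move=> n x _; rewrite lee_fin.
  - by move=> x _ a b ab; rewrite lee_fin nd_h.
transitivity (limn (fun n => \int[mu]_x ((g x)%:E * (h_ n x)%:E))); last first.
  under [RHS]eq_integral do rewrite ghE.
  apply/esym; apply: monotone_convergence => //.
  - by move=> n; apply: emeasurable_funM => //; exact/measurable_EFinP.
  - by move=> n x _; rewrite mule_ge0 ?lee_fin.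
  - by move=> x _ a b ab; rewrite lee_wpmul2l ?lee_fin// nd_h.
congr (limn _); apply/funext => n.
have term_ge0 y x : 0 <= (y * \1_(h_ n @^-1` [set y]) x)%:E.
  exact: nnfun_muleindic_ge0.
transitivity (\int[nu]_x (\sum_(y \in range (h_ n)) (y * \1_(h_ n @^-1` [set y]) x)%:E)).
  by apply: eq_integral => x _; rewrite fimfunE -fsumEFin.
transitivity (\int[mu]_x (\sum_(y \in range (h_ n))
    (g x)%:E * (y * \1_(h_ n @^-1` [set y]) x)%:E)); last first.
  apply: eq_integral => x _.
  by rewrite -ge0_mule_fsumr// fsumEFin// -fimfunE.
have mterm y : measurable_fun setT (fun x => (y * \1_(h_ n @^-1` [set y]) x)%:E).
  by apply/measurable_EFinP; exact: measurable_funM.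
rewrite ge0_integral_fsum//.
rewrite ge0_integral_fsum//; first last.
- by move=> y x _; apply: mule_ge0 => //; rewrite lee_fin.
- by move=> y; apply: emeasurable_funM.
apply: eq_fsbigr => y; rewrite inE => -[z _ yE].
have y0 : (0 <= y)%R by rewrite -yE.
under eq_integral do rewrite EFinM.
rewrite ge0_integralZl//; last exact/measurable_EFinP.
rewrite integral_indic// setIT nuE.
under [RHS]eq_integral do rewrite EFinM muleCA.
rewrite [RHS]ge0_integralZl//; last 2 first.
- by apply: emeasurable_funM => //; exact/measurable_EFinP.
- by move=> x _; rewrite mule_ge0// lee_fin.
congr (_ * _); rewrite integral_mkcond; apply: eq_integral => x _.
by rewrite epatch_indic.
Qed.

End density.

(** * The multivariate Gaussian integral *)

Lemma measurable_coord {R : realType} {m n : nat} (i : 'I_m) (j : 'I_n) :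
  measurable_fun [set: 'M[R]_(m, n)] (fun M => M i j : R).
Proof. exact: (measurable_fun_matrixP _).1 (@measurable_id _ _ setT) i j. Qed.

Lemma measurable_quad_form {R : realType} {n : nat} (A : 'M[R]_n) (m : 'cV[R]_n) :
  measurable_fun [set: 'cV[R]_n] (fun x => quad_form A (x - m)).
Proof.
have mB i : measurable_fun [set: 'cV[R]_n] (fun x => (x - m) i 0).
  under eq_fun do rewrite !mxE; apply: measurable_funB => //.
  exact: measurable_coord.
rewrite /quad_form; under eq_fun do rewrite mxE.
apply: measurable_sum => j; apply: measurable_funM => //.
under eq_fun do rewrite mxE; apply: measurable_sum => i.
apply: measurable_funM => //.
by under eq_fun do rewrite mxE; exact: mB.
Qed.

Lemma measurable_expR_quad_form {R : realType} {n : nat} (A : 'M[R]_n)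
    (m : 'cV[R]_n) :
  measurable_fun [set: 'cV[R]_n] (fun x => expR (- (quad_form A (x - m) / 2))).
Proof.
apply: measurableT_comp => //; apply: measurable_funN.
by apply: measurable_funM => //; exact: measurable_quad_form.
Qed.

Lemma gauss_integral1 {R : realType} (a mu : R) : 0 < a ->
  (\int[lebesgue_measure]_x (expR (- (a * (x - mu) ^+ 2 / 2)))%:E =
   ((2 * pi) `^ (1 / 2) * a `^ (- (1 / 2)))%:E)%E.
Proof.
move=> a0; have sa0 : 0 < Num.sqrt a by rewrite sqrtr_gt0.
pose s := (Num.sqrt a)^-1; have s0 : s != 0 by rewrite invr_neq0// gt_eqF.
have ssq : s ^+ 2 = a^-1 by rewrite exprVn sqr_sqrtr// ltW.
have pk0 : 0 < normal_peak s by exact: normal_peak_gt0.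
have -> : (2 * pi) `^ (1 / 2) * a `^ (- (1 / 2)) = (normal_peak s)^-1.
  rewrite powRN div1r !powR12_sqrt ?(ltW a0)//; last by rewrite mulr_ge0 ?pi_ge0.
  rewrite /normal_peak invrK ssq -mulrnAr [RHS]sqrtrM ?invr_ge0 ?(ltW a0)//.
  by rewrite sqrtrV ?(ltW a0)// [RHS]mulrC mulr_natl.
have /(congr1 (fun z => (normal_peak s)^-1%:E * z)%E) := integral_normal_pdf mu s.
rewrite mule1 => <-; rewrite -ge0_integralZl//; last 3 first.
- by apply/measurable_EFinP; exact: measurable_normal_pdf.
- by move=> x _; rewrite lee_fin normal_pdf_ge0.
- by rewrite lee_fin invr_ge0 ltW.
apply: eq_integral => x _; rewrite -EFinM normal_pdfE// mulKf ?gt_eqF//.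
rewrite /normal_fun ssq; congr (expR _)%:E.
by rewrite mulNr mulrC; congr (- _); field; rewrite gt_eqF.
Qed.

Lemma quad_form_block {R : realType} {n : nat} (a : R) (b : 'cV[R]_n)
    (D : 'M[R]_n) (x : R) (v : 'cV[R]_n) : a != 0 ->
  quad_form (block_mx (a%:M : 'M[R]_1) b^T b D) (cons_col (x, v)) =
  a * (x + a^-1 * (b^T *m v) 0 0) ^+ 2 + quad_form (D - a^-1 *: (b *m b^T)) v.
Proof.
move=> a0; rewrite /quad_form /cons_col /= tr_col_mx mul_row_block mul_row_col.
have -> : v^T *m (D - a^-1 *: (b *m b^T)) *m v =
    v^T *m D *m v - a^-1 *: ((v^T *m b) *m (b^T *m v)).
  by rewrite mulmxBr mulmxBl -scalemxAr -scalemxAl !mulmxA.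
rewrite tr_scalar_mx !mulmxDl -scalar_mxM !mul_scalar_mx mul_mx_scalar -scalemxAl.
have -> : v^T *m b = b^T *m v.
  by apply/matrixP => i j; rewrite !ord1 -[in LHS](trmxK b) -trmx_mul mxE.
move: (b^T *m v) (v^T *m D *m v) => B V.
rewrite !mxE big_ord1 eqxx !mulr1n; field; exact: a0.
Qed.

Lemma cons_colB {R : realType} {n : nat} (p q : R * 'cV[R]_n) :
  cons_col p - cons_col q = cons_col (p.1 - q.1, p.2 - q.2).
Proof.
rewrite /cons_col /= raddfB -[RHS]add_col_mx -opp_col_mx; reflexivity.
Qed.

Lemma cons_col_surj {R : realType} {n : nat} (v : 'cV[R]_n.+1) :
  exists p, v = cons_col p.
Proof.
exists (v 0 0, dsubmx (v : 'cV_(1 + n))); rewrite /cons_col /=.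
apply: (etrans (esym (vsubmxK (v : 'cV_(1 + n))))); congr (col_mx _ _).
by rewrite [LHS]mx11_scalar mxE; congr (v _ _)%:M; exact/val_inj.
Qed.

Lemma sym_posdef_block {R : realType} {n : nat} (A : 'M[R]_n.+1) :
  sym_posdef A -> exists a b (D : 'M[R]_n),
    [/\ A = block_mx (a%:M : 'M[R]_1) b^T b D, 0 < a,
        sym_posdef (D - a^-1 *: (b *m b^T)) &
        \det A = a * \det (D - a^-1 *: (b *m b^T))].
Proof.
move=> [As Apos]; pose A' : 'M[R]_(1 + n) := A.
pose a := A' 0 0; pose b : 'cV[R]_n := dlsubmx A'; pose D := drsubmx A'.
have AE : A = block_mx (a%:M : 'M[R]_1) b^T b D.
  apply: (etrans (esym (submxK A'))); congr (block_mx _ _ _ _).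
    by rewrite [LHS]mx11_scalar !mxE; congr (A' _ _)%:M; exact/val_inj.
  by rewrite /b trmx_dlsub; congr (ursubmx _); rewrite -[LHS]As.
have a0 : 0 < a.
  have nz : cons_col (1, 0) != 0 :> 'cV[R]_n.+1.
    apply/eqP => /(congr1 (fun v : 'cV[R]_(1 + n) => usubmx v 0 0)).
    by rewrite col_mxKu !mxE eqxx mulr1n => /eqP; rewrite oner_eq0.
  have qE : quad_form (block_mx (a%:M : 'M[R]_1) b^T b D) (cons_col (1, 0)) = a.
    rewrite /quad_form /cons_col /= tr_col_mx mul_row_block mul_row_col trmx0.
    rewrite !mul0mx mulmx0 !addr0 tr_scalar_mx !mul_scalar_mx !scale1r.
    by rewrite mul_mx_scalar scale1r !mxE eqxx mulr1n.
  by have := Apos _ nz; rewrite AE qE.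
have Ds : D^T = D by rewrite /D trmx_drsub; congr (drsubmx _).
exists a, b, D; split => //; first split.
- rewrite linearB/= Ds linearZ/= trmx_mul trmxK//.
- move=> v v0; have nz : cons_col (- (a^-1 * (b^T *m v) 0 0), v) != 0.
    apply: contraNneq v0 => /(congr1 (fun v : 'cV[R]_(1 + n) => dsubmx v)).
    by rewrite col_mxKd /= => ->; rewrite linear0.
  have := Apos _ nz; rewrite AE quad_form_block ?gt_eqF//.
  by rewrite addNr expr0n mulr0 add0r.
rewrite AE; pose L : 'M[R]_(1 + n) := block_mx 1%:M 0 (a^-1 *: b) 1%:M.
pose U : 'M[R]_(1 + n) := block_mx (a%:M : 'M[R]_1) b^T 0 (D - a^-1 *: (b *m b^T)).
have -> : block_mx (a%:M : 'M[R]_1) b^T b D = L *m U.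
  rewrite mulmx_block !mul1mx !mul0mx !addr0 mul_mx_scalar scalerA.
  by rewrite divff ?gt_eqF// scale1r -scalemxAl addrC subrK.
by rewrite [LHS](det_mulmx L U) det_lblock det_ublock !det1 !mul1r det_scalar1.
Qed.

Lemma ge0_integral_lebesgue_cVS {R : realType} {n : nat}
    (h : 'cV[R]_n.+1 -> \bar R) :
  measurable_fun setT h -> (forall x, 0 <= h x)%E ->
  (\int[lebesgue_cV n.+1]_x h x =
   \int[lebesgue_cV n]_v \int[lebesgue_measure]_x h (cons_col (x, v)))%E.
Proof.
move=> mh h0.
transitivity (\int[lebesgue_measure \x lebesgue_cV n]_p h (cons_col p))%E.
  have := @ge0_integral_pushforward _ _ (measurableTypeR R * 'cV[R]_n)%type _ R _
    measurable_cons_col (lebesgue_measure \x lebesgue_cV n)%E _ h measurableT mh.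
  by rewrite preimage_setT => <- // x _; exact: h0.
rewrite fubini_tonelli2//.
exact: measurableT_comp measurable_cons_col.
Qed.

Lemma gauss_integral {R : realType} {n : nat} (A : 'M[R]_n) (m : 'cV[R]_n) :
  sym_posdef A -> 0 < \det A /\
  (\int[lebesgue_cV n]_x (expR (- (quad_form A (x - m) / 2)))%:E =
   ((2 * pi) `^ (n%:R / 2) * \det A `^ (- (1 / 2)))%:E)%E.
Proof.
elim: n => [|n IH] in A m *.
  move=> _; rewrite det_mx00; split => //=.
  rewrite integral_dirac//; last first.
    by apply/measurable_EFinP; exact: measurable_expR_quad_form.
  rewrite diracT mul1e mul0r powRr0 powR1 mulr1 /quad_form.
  by rewrite [0 - m]flatmx0 mulmx0 mxE mul0r oppr0 expR0.
move=> Apos; have [a [b [D [AE a0 Spos detA]]]] := sym_posdef_block Apos.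
have [[m0 mv] mE] := cons_col_surj m.
have [detS IHS] := IH _ mv Spos.
split; first by rewrite detA mulr_gt0.
rewrite ge0_integral_lebesgue_cVS; last 2 first.
- by apply/measurable_EFinP; exact: measurable_expR_quad_form.
- by move=> x; rewrite lee_fin expR_ge0.
transitivity (\int[lebesgue_cV n]_v
   (((2 * pi) `^ (1 / 2) * a `^ (- (1 / 2)))%:E *
   (expR (- (quad_form (D - a^-1 *: (b *m b^T)) (v - mv) / 2)))%:E))%E.
  apply: eq_integral => v _.
  pose mu := m0 - a^-1 * (b^T *m (v - mv)) 0 0.
  rewrite -(gauss_integral1 mu a0) muleC -ge0_integralZl//; last first.
    apply/measurable_EFinP; apply: measurableT_comp => //.
    apply: measurable_funN; apply: measurable_funM => //.
    apply: measurable_funM => //; apply: measurable_funX.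
    exact: measurable_funB.
  apply: eq_integral => x _; rewrite -EFinM -expRD; congr (expR _)%:E.
  rewrite AE mE cons_colB quad_form_block ?gt_eqF//= /mu.
  by field; rewrite gt_eqF.
rewrite ge0_integralZl//; last 2 first.
- by apply/measurable_EFinP; exact: measurable_expR_quad_form.
- by rewrite lee_fin mulr_ge0// powR_ge0.
have pi2 : 0 < 2 * pi :> R by rewrite mulr_gt0// pi_gt0.
rewrite IHS -EFinM detA (@powRM _ a)// ?(ltW a0) ?(ltW detS)//.
rewrite (_ : n.+1%:R / 2 = 1 / 2 + n%:R / 2); last by rewrite -natr1; field.
rewrite powRD; last by rewrite gt_eqF ?implybT.
by congr _%:E; ring.
Qed.

(** * Measurability of convex and of lower semicontinuous functions *)

Lemma convex_function_le {R : realType} (E : lmodType R) (h : E -> R) :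
  convex_function (E := E) setT h ->
  forall (t : R) x y, 0 <= t <= 1 ->
    h (t *: x + (1 - t) *: y) <= t * h x + (1 - t) * h y.
Proof.
move=> ch t x y /andP[t0 t1].
have tP : Itv.spec (@Itv.num_sem R) (Itv.Real `[0%Z, 1%Z]) t.
  by apply/and3P; split; rewrite ?num_real// in_itv/= ?t0 ?t1.
have := ch (Itv.mk tP) x y; rewrite !inE => /(_ Logic.I Logic.I).
exact.
Qed.

Lemma convex_lt_open {R : realType} {n : nat} (h : 'cV[R]_n -> R) (c : R) :
  convex_function (E := 'cV[R]_n) setT h -> open [set x | h x < c].
Proof.
move=> /convex_function_le ch; rewrite openE => x /= hxc.
have coord (i : 'I_n) : exists2 r : R, 0 < r &
    forall s, `|s| < r -> h (x + s *: delta_mx i 0) < c.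
  pose M := 1 + `|h (x + delta_mx i 0)| + `|h (x - delta_mx i 0)| + `|h x|.
  have M0 : 0 < M by rewrite /M; do 3 (apply: ltr_wpDr => //).
  pose r := Num.min 1 ((c - h x) / (2 * M)).
  have r0 : 0 < r by rewrite lt_min ltr01 divr_gt0 ?subr_gt0 ?mulr_gt0.
  exists r => // s sr.
  have [s1 sM] : `|s| < 1 /\ `|s| * (2 * M) < c - h x.
    by move: sr; rewrite lt_min ltr_pdivlMr ?mulr_gt0// => /andP[].
  have key u : u = delta_mx i 0 \/ u = - delta_mx i 0 -> h (x + `|s| *: u) < c.
    move=> uE; have := ch `|s| (x + u) x; rewrite normr_ge0 ltW// => /(_ isT).
    rewrite (_ : `|s| *: (x + u) + (1 - `|s|) *: x = x + `|s| *: u); last first.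
      by apply/colP => j; rewrite !mxE; ring.
    move=> /le_lt_trans; apply.
    have hu : h (x + u) - h x <= 2 * M.
      have := ler_norm (h (x + u)); have := ler_norm (- h x); rewrite normrN.
      have := normr_ge0 (h (x + delta_mx i 0)).
      have := normr_ge0 (h (x - delta_mx i 0)).
      have := normr_ge0 (h x).
      by rewrite /M; case: uE => ->; lra.
    have := ler_wpM2l (normr_ge0 s) hu; lra.
  have [s0|s0] := leP 0 s.
    by have := key (delta_mx i 0) (or_introl erefl); rewrite ger0_norm.
  have := key (- delta_mx i 0) (or_intror erefl).
  by rewrite ltr0_norm// scalerN scaleNr opprK.
(* A point that moves along k + 1 coordinates is the midpoint of two points at
   twice the distance, one moving along k coordinates and one along the last. *)
have main k : (k <= n)%N -> exists2 r : R, 0 < r &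
    forall v : 'cV[R]_n, (forall i, `|v i 0| < r) ->
      (forall i : 'I_n, (k <= i)%N -> v i 0 = 0) -> h (x + v) < c.
  elim: k => [_|k IH kn].
    exists 1 => // v _ v0; rewrite (_ : v = 0) ?addr0//.
    by apply/colP => i; rewrite mxE v0.
  have [r1 r10 h1] := IH (ltnW kn).
  have [r2 r20 h2] := coord (Ordinal kn).
  exists (Num.min r1 r2 / 2); first by rewrite divr_gt0// lt_min r10.
  move=> v vr v0; pose K := Ordinal kn.
  have vr' i : 2 * `|v i 0| < r1 /\ 2 * `|v i 0| < r2.
    have := vr i; rewrite ltr_pdivlMr// mulrC lt_min => /andP[].
    by [].
  pose w := 2%:R *: (v - v K 0 *: delta_mx K 0).
  have hw : h (x + w) < c.
    apply: h1 => i; rewrite !mxE eqxx andbT.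
      have [->|iK] := eqVneq i K; first by rewrite mulr1 subrr mulr0 normr0.
      by rewrite mulr0 subr0 normrM ger0_norm//; have [] := vr' i.
    move=> ki; have [->|iK] := eqVneq i K; first by rewrite mulr1 subrr mulr0.
    rewrite mulr0 subr0 v0 ?mulr0// ltn_neqAle ki andbT.
    by apply: contra iK => /eqP kE; apply/eqP/val_inj.
  have hK : h (x + (2 * v K 0) *: delta_mx K 0) < c.
    by apply: h2; rewrite normrM ger0_norm//; have [] := vr' K.
  have := ch (2^-1) (x + w) (x + (2 * v K 0) *: delta_mx K 0).
  rewrite (_ : _ *: _ + _ = x + v); last first.
    by apply/colP => i; rewrite !mxE; field.
  have h01 : 0 <= (2^-1 : R) <= 1 by lra.
  by move=> /(_ h01) /le_lt_trans; apply; lra.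
have [r r0 hr] := main n (leqnn n).
apply/nbhs_ballP; exists r => //= y [_ xy].
rewrite -[y](subrK x) addrC; apply: hr => i; last by rewrite leqNgt ltn_ord.
by rewrite !mxE distrC; exact: xy.
Qed.

Lemma convex_measurable {R : realType} {n : nat} (h : 'cV[R]_n -> R) :
  convex_function (E := 'cV[R]_n) setT h -> measurable_fun setT h.
Proof.
move=> ch; apply: (measurability _ (RGenInftyO.measurableE R)) => _ [_ [a ->] <-].
rewrite setTI; apply: sub_sigma_algebra.
rewrite (_ : _ @^-1` _ = [set x | h x < a]); first exact: convex_lt_open.
by apply/seteqP; split => x /=; rewrite in_itv.
Qed.

Lemma measurable_open_pair {R : realType} {m n : nat}
    (U : set ('cV[R]_m * 'cV[R]_n)) : open U -> measurable U.
Proof.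
move=> oU; pose V := [set M : 'cV[R]_(m + n) | U (usubmx M, dsubmx M)].
have oV : open V.
  rewrite openE => M VM.
  have /nbhs_ballP[e /= e0 eU] : nbhs (usubmx M, dsubmx M) U by exact: open_nbhs_nbhs.
  apply/nbhs_ballP; exists e => //= N [_ MN]; apply: eU.
  by split; split => // i j; rewrite !mxE; exact: MN.
pose phi (p : 'cV[R]_m * 'cV[R]_n) : 'cV[R]_(m + n) := col_mx p.1 p.2.
have mphi : measurable_fun setT phi.
  apply/measurable_fun_matrixP => i j.
  have -> : (fun x => phi x i j) = (fun p => match fintype.split i with
      inl k => p.1 k j | inr k => p.2 k j end).
    by apply/funext => p; rewrite mxE; case: fintype.split.
  case: fintype.split => k.
    exact: ((measurable_fun_matrixP fst).1 measurable_fst k j).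
  exact: ((measurable_fun_matrixP snd).1 measurable_snd k j).
have -> : U = setT `&` phi @^-1` V.
  rewrite setTI; apply/funext => -[x y].
  by rewrite /V /phi /= col_mxKu col_mxKd.
by apply: mphi => //; exact: sub_sigma_algebra.
Qed.

Lemma lower_semicontinuous_measurable_pair {R : realType} {m n : nat}
    (r : 'cV[R]_m * 'cV[R]_n -> R) :
  lower_semicontinuous (fun p => (r p)%:E) -> measurable_fun setT r.
Proof.
move=> /lower_semicontinuousP lr.
apply: (measurability _ (RGenOInfty.measurableE R)) => _ [_ [a ->] <-].
rewrite setTI; apply: measurable_open_pair.
rewrite (_ : _ @^-1` _ = [set x | a%:E < (r x)%:E]%E); first exact: lr.
by apply/seteqP; split => x /=; rewrite in_itv/= andbT lte_fin.
Qed.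

(** * Iterates of the Metropolis-Hastings independence kernel *)

Section mhi_kernel_theory.
Context {R : realType} {d : nat}.
Variables p q : 'cV[R]_d -> R.
Hypotheses (mp : measurable_fun setT p) (mq : measurable_fun setT q).
Hypotheses (p_gt0 : forall x, 0 < p x) (q_gt0 : forall x, 0 < q x).
Hypothesis q_le1 : (\int[lebesgue_cV d]_x (q x)%:E <= 1)%E.
Local Open Scope ereal_scope.
Notation mu := (lebesgue_cV d).

Let k x y : R := (mhi_accept p q x y * q y)%R.

Let k_ge0 x y : (0 <= k x y)%R.
Proof.
by rewrite /k mulr_ge0 ?(ltW (q_gt0 _))// le_min ler01 andbT divr_ge0// ltW// mulr_gt0.
Qed.

Let k_le x y : (k x y <= q y)%R.
Proof. by rewrite /k ler_piMl ?(ltW (q_gt0 _))// ge_min lexx orbT. Qed.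

Let detailed_balance x y : (p x * k x y = p y * k y x)%R.
Proof.
have pqE u v : (p u * k u v = Num.min (p v * q u) (p u * q v))%R.
  have pq0 := mulr_gt0 (p_gt0 u) (q_gt0 v).
  rewrite /k /mhi_accept mulrCA mulrC minr_pMr ?(ltW pq0)// mulr1.
  by rewrite [X in Num.min X]mulrC divfK// gt_eqF.
by rewrite !pqE minC.
Qed.

Let mk : measurable_fun [set: 'cV[R]_d * 'cV[R]_d] (fun z => k z.1 z.2).
Proof.
have m1 (u : 'cV[R]_d -> R) : measurable_fun setT u ->
    measurable_fun [set: 'cV[R]_d * 'cV[R]_d] (fun z => u z.1).
  by move=> mu'; apply: measurableT_comp.
have m2 (u : 'cV[R]_d -> R) : measurable_fun setT u ->
    measurable_fun [set: 'cV[R]_d * 'cV[R]_d] (fun z => u z.2).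
  by move=> mu'; apply: measurableT_comp.
apply: measurable_funM; last exact: m2.
apply: measurable_minr => //; apply: measurable_funM.
  by apply: measurable_funM; [exact: m2|exact: m1].
under eq_fun do rewrite -powR_inv1 ?ltW ?mulr_gt0//.
apply: measurableT_comp (measurable_powR _) _.
by apply: measurable_funM; [exact: m1|exact: m2].
Qed.

Let mk1 x : measurable_fun [set: 'cV[R]_d] (k x).
Proof. exact: measurableT_comp mk (pair1_measurable x). Qed.

Let A x := \int[mu]_y (k x y)%:E.

Let A_ge0 x : 0 <= A x.
Proof. by apply: integral_ge0 => y _; rewrite lee_fin. Qed.

Let A_le1 x : A x <= 1.
Proof.
apply: le_trans q_le1; apply: ge0_le_integral => //.
- by move=> y _; rewrite lee_fin.
- exact/measurable_EFinP.
- exact/measurable_EFinP.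
- by move=> y _; rewrite lee_fin.
Qed.

Let A_fin x : A x \is a fin_num.
Proof. by rewrite ge0_fin_numE// (le_lt_trans (A_le1 x))// ltry. Qed.

Let subA_ge0 x : 0 <= 1 - A x.
Proof. by rewrite sube_ge0 ?A_le1// A_fin. Qed.

Let mA : measurable_fun setT A.
Proof.
apply: (measurable_fun_fubini_tonelli_F (fun z => (k z.1 z.2)%:E)).
  exact/measurable_EFinP.
by move=> z; rewrite lee_fin.
Qed.

Let step (h : 'cV[R]_d -> \bar R) x := \int[mu]_y ((k x y)%:E * h y) + h x * (1 - A x).

Let step_ge0 h : (forall x, 0 <= h x) -> forall x, 0 <= step h x.
Proof.
move=> h0 x; apply: adde_ge0; last exact: mule_ge0.
by apply: integral_ge0 => y _; rewrite mule_ge0// lee_fin.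
Qed.

Let mkh h : measurable_fun setT h ->
  measurable_fun [set: 'cV[R]_d * 'cV[R]_d] (fun z => (k z.1 z.2)%:E * h z.2).
Proof.
move=> mh; apply: emeasurable_funM; first exact/measurable_EFinP.
exact: measurableT_comp.
Qed.

Let mstep1 h : measurable_fun setT h -> (forall x, 0 <= h x) ->
  measurable_fun setT (fun x => \int[mu]_y ((k x y)%:E * h y)).
Proof.
move=> mh h0.
apply: (measurable_fun_fubini_tonelli_F (fun z => (k z.1 z.2)%:E * h z.2)).
  exact: mkh.
by move=> z; rewrite mule_ge0// lee_fin.
Qed.

Let mstep2 h : measurable_fun setT h ->
  measurable_fun setT (fun x => h x * (1 - A x)).
Proof.
by move=> mh; apply: emeasurable_funM => //; apply: emeasurable_funB.
Qed.

Let measurable_step h : measurable_fun setT h -> (forall x, 0 <= h x) ->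
  measurable_fun setT (step h).
Proof. by move=> mh h0; apply: emeasurable_funD; [exact: mstep1|exact: mstep2]. Qed.

Let integral_mhi_kernel x h : measurable_fun setT h -> (forall x, 0 <= h x) ->
  \int[mhi_kernel p q x]_y h y = step h x.
Proof.
move=> mh h0; have [nu nuE] := density_is_measure mu (mk1 x) (k_ge0 x).
have r0 : (0 <= 1 - fine (A x))%R by rewrite subr_ge0 -lee_fin fineK// A_le1.
have -> : mhi_kernel p q x =
    measure_add nu (mscale (NngNum r0) (\d_x : {measure set 'cV[R]_d -> \bar R})).
  apply/funext => B; rewrite measure_addE nuE /= /mscale /mhi_kernel /=.
  by rewrite EFinB fineK// [in RHS]muleC.
rewrite ge0_integral_measure_add// ge0_integral_mscale// integral_dirac//.
rewrite diracT mul1e /= EFinB fineK// [in LHS]muleC; congr (_ + _).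
rewrite -ge0_integral_density//.
by congr (integral _ _ _); apply/funext => B; rewrite nuE.
Qed.

Let kernel_iterS t x B : measurable B ->
  (forall x, 0 <= kernel_iter (mhi_kernel p q) t x B) ->
  measurable_fun setT (fun x => kernel_iter (mhi_kernel p q) t x B) ->
  kernel_iter (mhi_kernel p q) t.+1 x B =
  step (fun y => kernel_iter (mhi_kernel p q) t y B) x.
Proof.
case: t => [|t] mB h0 mh; last exact: integral_mhi_kernel.
rewrite /= /mhi_kernel /step; congr (_ + _).
by rewrite integral_mkcond epatch_indic.
Qed.

Let kernel_iter_ge0_measurable t B : measurable B ->
  (forall x, 0 <= kernel_iter (mhi_kernel p q) t x B) /\
  measurable_fun setT (fun x => kernel_iter (mhi_kernel p q) t x B).
Proof.
move=> mB; elim: t => [|t [h0 mh]]; first by split=> //; exact: measurable_fun_dirac.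
have -> : (fun x => kernel_iter (mhi_kernel p q) t.+1 x B) =
    step (fun y => kernel_iter (mhi_kernel p q) t y B).
  by apply/funext => x; exact: kernel_iterS.
by split=> [x|]; [rewrite kernel_iterS//; exact: step_ge0|exact: measurable_step].
Qed.

Let invariant_step h : measurable_fun setT h -> (forall x, 0 <= h x) ->
  \int[mu]_x ((p x)%:E * step h x) = \int[mu]_x ((p x)%:E * h x).
Proof.
move=> mh h0; have pE0 x : 0 <= (p x)%:E by rewrite lee_fin ltW.
have mpE : measurable_fun setT (fun x => (p x)%:E) by exact/measurable_EFinP.
have i0 x : 0 <= \int[mu]_y ((k x y)%:E * h y).
  by apply: integral_ge0 => y _; rewrite mule_ge0// lee_fin.
transitivity (\int[mu]_x ((p x)%:E * \int[mu]_y ((k x y)%:E * h y)) +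
              \int[mu]_x ((p x)%:E * (h x * (1 - A x)))).
  rewrite -ge0_integralD//; last 4 first.
  - by move=> x _; rewrite mule_ge0.
  - by apply: emeasurable_funM => //; exact: mstep1.
  - by move=> x _; rewrite !mule_ge0.
  - by apply: emeasurable_funM => //; exact: mstep2.
  by apply: eq_integral => x _; rewrite ge0_muleDr// mule_ge0.
transitivity (\int[mu]_y ((p y)%:E * (h y * A y)) +
              \int[mu]_x ((p x)%:E * (h x * (1 - A x)))); last first.
  rewrite -ge0_integralD//; last 4 first.
  - by move=> x _; rewrite !mule_ge0.
  - by do 2 apply: emeasurable_funM => //.
  - by move=> x _; rewrite !mule_ge0.
  - by apply: emeasurable_funM => //; exact: mstep2.
  apply: eq_integral => x _; rewrite -ge0_muleDr ?mule_ge0//.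
  by rewrite -ge0_muleDr// addeC subeK// mule1.
congr (_ + _).
transitivity (\int[mu]_x \int[mu]_y ((p x * k x y)%:E * h y)).
  apply: eq_integral => x _; rewrite -ge0_integralZl//; last 2 first.
  - by apply: emeasurable_funM => //; exact/measurable_EFinP.
  - by move=> y _; rewrite mule_ge0// lee_fin.
  by apply: eq_integral => y _; rewrite EFinM muleA.
rewrite (fubini_tonelli (fun z => (p z.1 * k z.1 z.2)%:E * h z.2))/=; last 2 first.
- apply: emeasurable_funM; last exact: measurableT_comp.
  apply/measurable_EFinP; apply: measurable_funM => //.
  exact: measurableT_comp.
- by move=> z; rewrite mule_ge0// lee_fin mulr_ge0// ltW.
apply: eq_integral => y _; rewrite /A muleA -ge0_integralZl//; last 3 first.
- exact/measurable_EFinP.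
- by move=> x _; rewrite lee_fin.
- by rewrite mule_ge0.
by apply: eq_integral => x _; rewrite detailed_balance EFinM muleAC.
Qed.

Let invariant_iter t B : measurable B ->
  \int[mu]_x ((p x)%:E * kernel_iter (mhi_kernel p q) t x B) = density_measure p B.
Proof.
move=> mB; elim: t => [|t IH].
  rewrite /density_measure [RHS]integral_mkcond epatch_indic.
  by apply: eq_integral.
have [h0 mh] := kernel_iter_ge0_measurable t mB.
under eq_integral do rewrite kernel_iterS//.
by rewrite invariant_step.
Qed.

Lemma kernel_iter_mhi_minimizer (x0 : 'cV[R]_d) (e : R) (t : nat) (B : set 'cV[R]_d) :
  \int[mu]_x (p x)%:E = 1 -> (0 <= e <= 1)%R ->
  (forall y, mhi_accept p q x0 y * q y = e * p y)%R -> measurable B ->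
  kernel_iter (mhi_kernel p q) t x0 B =
  (1 - (1 - e) ^+ t)%:E * density_measure p B + ((1 - e) ^+ t)%:E * \d_x0 B.
Proof.
move=> p1 /andP[e0 e1] kE mB.
have pE0 x : 0 <= (p x)%:E by rewrite lee_fin ltW.
have mpE : measurable_fun setT (fun x => (p x)%:E) by exact/measurable_EFinP.
have Ax0 : A x0 = e%:E.
  rewrite /A; under eq_integral do rewrite /k kE EFinM.
  by rewrite ge0_integralZl// p1 mule1.
elim: t => [|t IH]; first by rewrite !expr0 subrr mul0e add0e mul1e.
have [h0 mh] := kernel_iter_ge0_measurable t mB.
rewrite kernel_iterS// /step Ax0.
under eq_integral do rewrite /k kE EFinM -muleA.
rewrite ge0_integralZl//; last 2 first.
- by apply: emeasurable_funM.
- by move=> x _; rewrite mule_ge0.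
rewrite invariant_iter// IH.
have l01 : (0 <= (1 - e) ^+ t <= 1)%R by rewrite exprn_ge0 ?exprn_ile1//; lra.
have P0 : 0 <= density_measure p B by apply: integral_ge0.
have D0 : 0 <= \d_x0 B :> \bar R by [].
move: l01 P0 D0; rewrite exprS.
move: (density_measure p B) (\d_x0 B : \bar R) ((1 - e) ^+ t)%R => P D l /andP[l0 l1] P0 D0.
rewrite -EFinB ge0_muleDl ?mule_ge0 ?lee_fin ?subr_ge0//.
rewrite muleAC -EFinM [l%:E * D * _]muleAC -EFinM addeA -ge0_muleDl ?lee_fin; last 2 first.
- done.
- by rewrite mulr_ge0// subr_ge0.
by congr (_%:E * _ + _%:E * _); ring.
Qed.

End mhi_kernel_theory.

(** * Transport from a mixture with a Dirac mass *)

Lemma measure_is_probability {d : measure_display} {T : measurableType d}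
    {R : realType} (nu : {measure set T -> \bar R}) : nu setT = 1%E ->
  exists P : probability T R, forall B, P B = nu B.
Proof.
move=> nu1; exists (mnormalize nu point) => B.
by rewrite /= /mnormalize nu1 onee_eq0/= invr1 mule1.
Qed.

Lemma pushforward_is_measure {d d' : measure_display} {T : measurableType d}
    {T' : measurableType d'} {R : realType} (nu : {measure set T -> \bar R})
    (phi : T -> T') : measurable_fun setT phi ->
  exists nu' : {measure set T' -> \bar R}, forall A, nu' A = nu (phi @^-1` A).
Proof.
move=> mphi; unshelve eexists; first by refine (pushforward nu phi).
by [].
Qed.
Lemma ge0_integral_image {d d' : measure_display} {T : measurableType d}
    {T' : measurableType d'} {R : realType} (nu : {measure set T -> \bar R})
    (nu' : {measure set T' -> \bar R}) (phi : T -> T') (h : T' -> \bar R) :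
  measurable_fun setT phi ->
  (forall B, measurable B -> nu (phi @^-1` B) = nu' B) ->
  measurable_fun setT h -> (forall x, 0 <= h x)%E ->
  (\int[nu]_x h (phi x) = \int[nu']_x h x)%E.
Proof.
move=> mphi nuE mh h0; have [n1 n1E] := pushforward_is_measure nu mphi.
rewrite [RHS](eq_measure_integral n1); last by move=> B mB _; rewrite n1E nuE.
have -> : n1 = pushforward nu phi :> (set _ -> \bar R) by apply/funext => B; rewrite n1E.
by rewrite ge0_integral_pushforward.
Qed.

Section wasserstein_mixture.
Context {d : measure_display} {T : measurableType d} {R : realType}.
Variables (rho : T -> T -> R) (nu : {measure set T -> \bar R}).
Variables (m : set T -> \bar R) (l : R) (x0 : T).
Hypothesis rho_metric : is_metric rho.
Hypothesis mrho : measurable_fun setT (fun p : T * T => rho p.1 p.2).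
Hypothesis nu1 : nu setT = 1%E.
Hypothesis l01 : 0 <= l <= 1.
Hypothesis mE : forall B, measurable B ->
  m B = ((1 - l)%:E * nu B + l%:E * \d_x0 B)%E.
Local Open Scope ereal_scope.

Let l0 : (0 <= l)%R. Proof. by case/andP: l01. Qed.
Let l1 : (0 <= 1 - l)%R. Proof. by case/andP: l01; rewrite subr_ge0. Qed.

Let rho0 x y : (0 <= rho x y)%R. Proof. by case: rho_metric. Qed.
Let rhoxx x : rho x x = 0%R. Proof. by case: rho_metric => _ H _ _; apply/H. Qed.
Let rhoC x y : rho x y = rho y x. Proof. by case: rho_metric. Qed.
Let rhoD x y z : (rho x z <= rho x y + rho y z)%R. Proof. by case: rho_metric. Qed.

Let mrhox0 : measurable_fun setT (fun x => rho x x0).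
Proof. exact: measurableT_comp mrho (pair2_measurable x0). Qed.

Let mdiag : measurable_fun setT (fun x : T => (x, x)).
Proof. by apply/measurable_fun_pairP; split; exact: measurable_id. Qed.

Let mrow : measurable_fun setT (fun x : T => (x0, x)).
Proof. exact: pair1_measurable. Qed.

Let mixture_coupling : exists2 xi : probability (T * T)%type R,
  couplings m nu xi & \int[xi]_p (rho p.1 p.2)%:E =
    l%:E * \int[nu]_x (rho x x0)%:E.
Proof.
have [n1 n1E] := pushforward_is_measure nu mdiag.
have [n2 n2E] := pushforward_is_measure nu mrow.
pose xi0 := measure_add (mscale (NngNum l1) n1) (mscale (NngNum l0) n2).
have xi0E B : xi0 B = (1 - l)%:E * n1 B + l%:E * n2 B by rewrite /xi0 measure_addE.
have xi0T : xi0 setT = 1.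
  by rewrite xi0E n1E n2E !preimage_setT nu1 !mule1 -EFinD subrK.
have [xi xiE] := measure_is_probability xi0T.
have xiE' B : xi B = (1 - l)%:E * n1 B + l%:E * n2 B := etrans (xiE B) (xi0E B).
exists xi.
  move=> B mB; rewrite !xiE' !n1E !n2E mE//; split.
    congr (_ * _ + _ * _); first by congr (nu _); apply/seteqP; split=> x //= -[].
    rewrite diracE; have [/set_mem Bx|/negP] := boolP (x0 \in B).
      by rewrite (_ : _ @^-1` _ = setT)//; apply/seteqP; split.
    rewrite inE => Bx.
    by rewrite (_ : _ @^-1` _ = set0) ?measure0//; apply/seteqP; split=> x // -[].
  rewrite (_ : _ @^-1` _ = B); last by apply/seteqP; split=> x //= -[].
  rewrite (_ : (fun x => (x0, x)) @^-1` _ = B); last by apply/seteqP; split=> x //= -[].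
  by rewrite -ge0_muleDl ?lee_fin// -EFinD subrK mul1e.
have mrE : measurable_fun setT (fun p : T * T => (rho p.1 p.2)%:E).
  exact/measurable_EFinP.
have rE0 (p : T * T) : 0 <= (rho p.1 p.2)%:E by rewrite lee_fin.
rewrite (eq_measure_integral xi0); last by move=> B _ _; exact: xiE.
rewrite ge0_integral_measure_add// !ge0_integral_mscale//=.
rewrite -(ge0_integral_image mdiag (fun B _ => esym (n1E B)))//.
rewrite -(ge0_integral_image mrow (fun B _ => esym (n2E B)))//=.
rewrite integral0_eq; last by move=> x _; rewrite /= rhoxx.
rewrite mule0 add0e; congr (_ * _); apply: eq_integral => x _.
by rewrite /= rhoC.
Qed.

Let coupling_lower_bound (xi : probability (T * T)%type R) :
  couplings m nu xi ->
  l%:E * \int[nu]_x (rho x x0)%:E <= \int[xi]_p (rho p.1 p.2)%:E.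
Proof.
move=> xiC.
pose phi (n : nat) x : R := Num.min (rho x x0) n%:R.
have phi0 n x : (0 <= phi n x)%R by rewrite le_min rho0/=.
have mphi n : measurable_fun setT (fun x => (phi n x)%:E).
  by apply/measurable_EFinP; apply: measurable_minr.
have phi_lip n x y : (phi n y <= rho x y + phi n x)%R.
  rewrite /phi addr_minr le_min !ge_min; apply/andP; split.
    by rewrite (rhoC x y) rhoD.
  by rewrite lerDr rho0 orbT.
have fst_int n : \int[xi]_p (phi n p.1)%:E = (1 - l)%:E * \int[nu]_x (phi n x)%:E.
  pose m' := measure_add (mscale (NngNum l1) nu)
    (mscale (NngNum l0) (\d_x0 : {measure set T -> \bar R})).
  have xim' B : measurable B -> xi (fst @^-1` B) = m' B.
    move=> mB; rewrite /m' measure_addE /= /mscale /= -mE//.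
    have [<- _] := xiC _ mB; congr (xi _).
    by apply/seteqP; split=> -[x y] //= [].
  rewrite (ge0_integral_image measurable_fst xim' (mphi n)); last first.
    by move=> x; rewrite lee_fin.
  rewrite ge0_integral_measure_add//; last by move=> x _; rewrite lee_fin.
  rewrite !ge0_integral_mscale//; [|by move=> x _; rewrite lee_fin..].
  rewrite integral_dirac// /phi rhoxx/= diracT mul1e.
  by rewrite (min_idPl _)// mule0 adde0.
have snd_int n : \int[xi]_p (phi n p.2)%:E = \int[nu]_x (phi n x)%:E.
  apply: (ge0_integral_image measurable_snd _ (mphi n)).
    move=> B mB; have [_ <-] := xiC _ mB; congr (xi _).
    by apply/seteqP; split=> -[x y] //= [].
  by move=> x; rewrite lee_fin.
have fin n : \int[nu]_x (phi n x)%:E \is a fin_num.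
  rewrite ge0_fin_numE; last by apply: integral_ge0 => x _; rewrite lee_fin.
  apply: (@le_lt_trans _ _ (\int[nu]_x (n%:R)%:E)); last first.
    by rewrite integral_cst// nu1 mule1 ltry.
  apply: ge0_le_integral => //.
  - by move=> x _; rewrite lee_fin.
  - by move=> x _; rewrite lee_fin ge_min lexx orbT.
have mrE : measurable_fun setT (fun p : T * T => (rho p.1 p.2)%:E).
  exact/measurable_EFinP.
have bound n : l%:E * \int[nu]_x (phi n x)%:E <= \int[xi]_p (rho p.1 p.2)%:E.
  have : \int[nu]_x (phi n x)%:E <=
      \int[xi]_p (rho p.1 p.2)%:E + (1 - l)%:E * \int[nu]_x (phi n x)%:E.
    rewrite -fst_int -snd_int -ge0_integralD//; last 3 first.
    - by move=> p _; rewrite lee_fin.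
    - by move=> p _; rewrite lee_fin.
    - exact: measurableT_comp (mphi n) measurable_fst.
    apply: ge0_le_integral => //.
    - by move=> p _; rewrite lee_fin.
    - exact: measurableT_comp (mphi n) measurable_snd.
    - apply: emeasurable_funD => //.
      exact: measurableT_comp (mphi n) measurable_fst.
    - by move=> p _; rewrite lee_fin.
  have : 0 <= \int[xi]_p (rho p.1 p.2)%:E.
    by apply: integral_ge0 => p _; rewrite lee_fin.
  rewrite -(fineK (fin n)); move: (fine _) => r.
  case: (\int[xi]_p _) => [j||]//; last by rewrite !leey.
  by rewrite -!EFinM -EFinD !lee_fin; lra.
have lim : (fun n => l%:E * \int[nu]_x (phi n x)%:E) @ \oo -->
    l%:E * \int[nu]_x (rho x x0)%:E.
  have rhoE x : (rho x x0)%:E = limn (fun n => (phi n x)%:E).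
    apply/esym/cvg_lim => //; apply: cvg_near_cst; near=> n.
    congr _%:E; apply/min_idPl; near: n; exact: nbhs_infty_ger.
  under [in X in _ --> X]eq_integral do rewrite rhoE.
  apply: cvgeZl => //; apply: cvg_monotone_convergence => //.
    by move=> n x _; rewrite lee_fin.
  move=> x _ a b ab; rewrite lee_fin /phi le_min ge_min lexx/=.
  by rewrite ge_min ler_nat ab orbT.
by apply: (cvge_le _ lim); exact: nearW.
Unshelve. all: by end_near.
Qed.

Lemma wasserstein_mixture :
  wasserstein rho m nu = l%:E * \int[nu]_x (rho x x0)%:E.
Proof.
apply/eqP; rewrite eq_le; apply/andP; split.
  have [xi xiC <-] := mixture_coupling.
  by apply: ereal_inf_lbound; exists xi.
by apply: le_ereal_inf_tmp => _ [xi xiC <-]; exact: coupling_lower_bound.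
Qed.

End wasserstein_mixture.

(** * Strong convexity and Gaussian densities *)

Lemma quad_formD {R : realType} {n : nat} (A : 'M[R]_n) (s t : R) (x y : 'cV[R]_n) :
  quad_form A (s *: x + t *: y) =
  s ^+ 2 * quad_form A x + s * t * ((x^T *m A *m y) 0 0 + (y^T *m A *m x) 0 0)
  + t ^+ 2 * quad_form A y.
Proof.
rewrite /quad_form; have -> : (s *: x + t *: y)^T = s *: x^T + t *: y^T by rewrite linearD !linearZ.
rewrite !mulmxDl !mulmxDr -!scalemxAl -!scalemxAr !mxE; ring.
Qed.

Lemma strongly_convex_subgradient {R : realType} {n : nat} (f : 'cV[R]_n -> R)
    (A : 'M[R]_n) (x g : 'cV[R]_n) :
  convex_function (E := 'cV[R]_n) setT (fun y => f y - quad_form A y / 2) ->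
  is_subgradient f x g ->
  forall y, f x + (g^T *m (y - x)) 0 0 + quad_form A (y - x) / 2 <= f y.
Proof.
move=> /convex_function_le cf gf y.
set D := (g^T *m _) 0 0; set Q := quad_form A _.
have slope t : 0 < t <= 1 -> (1 - t) * (Q / 2) <= f y - f x - D.
  move=> /andP[t0 t1].
  have := cf t y x; rewrite (ltW t0) t1 => /(_ isT).
  have QE : quad_form A (t *: y + (1 - t) *: x) =
      t * quad_form A y + (1 - t) * quad_form A x - t * (1 - t) * Q.
    have -> : Q = quad_form A (1 *: y + (-1) *: x) by rewrite scale1r scaleN1r.
    by rewrite !quad_formD; ring.
  have := gf (t *: y + (1 - t) *: x).
  have -> : t *: y + (1 - t) *: x - x = t *: (y - x).
    by apply/colP => i; rewrite !mxE; ring.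
  rewrite -scalemxAr mxE -/D QE => h1 h2.
  by rewrite -(ler_pM2l t0); lra.
rewrite leNgt; apply/negP => lt.
have D0 := slope 1; rewrite ltr01 lexx subrr mul0r in D0; have {}D0 := D0 isT.
have Q0 : 0 < Q by lra.
pose t := (Q / 2 - (f y - f x - D)) / Q.
have tQ : t * Q = Q / 2 - (f y - f x - D) by rewrite /t divfK// gt_eqF.
have t0 : 0 < t by rewrite divr_gt0//; lra.
have t1 : t <= 1 by rewrite ler_pdivrMr//; lra.
have := slope t; rewrite t0 t1 => /(_ isT); lra.
Qed.

Lemma sym_posdef_unitmx {R : realType} {n : nat} (S : 'M[R]_n) :
  sym_posdef S -> S \in unitmx.
Proof.
by move=> /(gauss_integral 0)[dS _]; rewrite unitmxE unitfE gt_eqF.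
Qed.

Lemma sym_posdef_invmx {R : realType} {n : nat} (S : 'M[R]_n) :
  sym_posdef S -> sym_posdef (invmx S).
Proof.
move=> Spos; have uS := sym_posdef_unitmx Spos; have [Ss Sx] := Spos.
have sym : (invmx S)^T = invmx S by rewrite trmx_inv Ss.
split=> // x x0; have nz : invmx S *m x != 0.
  by apply: contraNneq x0 => /(congr1 (mulmx S)); rewrite mulKVmx// mulmx0 => ->.
by have := Sx _ nz; rewrite /quad_form trmx_mul sym mulmxA mulmxKV.
Qed.

Lemma sym_posdefZ {R : realType} {n : nat} (a : R) (S : 'M[R]_n) :
  0 < a -> sym_posdef S -> sym_posdef (a *: S).
Proof.
move=> a0 [Ss Sx]; split=> [|x x0]; first by rewrite linearZ/= Ss.
by rewrite /quad_form -scalemxAr -scalemxAl mxE mulr_gt0//; exact: Sx.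
Qed.

Lemma quad_form_complete_square {R : realType} {n : nat} (S : 'M[R]_n)
    (g u : 'cV[R]_n) : sym_posdef S ->
  quad_form (invmx S) (u + S *m g) =
  quad_form (invmx S) u + 2 * (g^T *m u) 0 0 + quad_form S g.
Proof.
move=> Spos; have uS := sym_posdef_unitmx Spos; have [Ss _] := Spos.
have := quad_formD (invmx S) 1 1 u (S *m g); rewrite !scale1r => ->.
have -> : u^T *m invmx S *m (S *m g) = (g^T *m u)^T.
  by rewrite trmx_mul trmxK mulmxA mulmxKV.
have -> : (S *m g)^T *m invmx S *m u = g^T *m u by rewrite trmx_mul Ss mulmxK.
have -> : quad_form (invmx S) (S *m g) = quad_form S g.
  by rewrite /quad_form trmx_mul Ss mulmxK// mulmxA.
by rewrite [(_^T) 0 0]mxE; ring.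
Qed.

Lemma integral_normal_density {R : realType} {n : nat} (m : 'cV[R]_n) (S : 'M[R]_n) :
  sym_posdef S -> (\int[lebesgue_cV n]_x (normal_density m S x)%:E = 1)%E.
Proof.
move=> Spos; have [_ IG] := gauss_integral m (sym_posdef_invmx Spos).
have [dS _] := gauss_integral 0 Spos.
have pi2 : 0 < 2 * pi :> R by rewrite mulr_gt0// pi_gt0.
rewrite /normal_density; under eq_integral do rewrite EFinM.
rewrite ge0_integralZl//; last 2 first.
- by apply/measurable_EFinP; exact: measurable_expR_quad_form.
- by rewrite lee_fin mulr_ge0// powR_ge0.
rewrite IG -EFinM det_inv; congr _%:E.
rewrite -(powR_inv1 (ltW dS)) -powRrM mulN1r opprK powRN mulrACA mulVf; last first.
  by apply: lt0r_neq0; exact: powR_gt0.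
by rewrite powRN mulVf ?mulr1//; apply: lt0r_neq0; exact: powR_gt0.
Qed.

Lemma measurable_gibbs_density {R : realType} {n : nat} (f : 'cV[R]_n -> R) :
  measurable_fun setT f -> measurable_fun setT (gibbs_density f).
Proof.
move=> mf; apply: measurable_funM => //; apply: measurableT_comp => //.
exact: measurable_funN.
Qed.

Lemma measurable_normal_density {R : realType} {n : nat} (m : 'cV[R]_n) (S : 'M[R]_n) :
  measurable_fun setT (normal_density m S).
Proof. by apply: measurable_funM => //; exact: measurable_expR_quad_form. Qed.

Lemma integral_gibbs_density {R : realType} {n : nat} (f : 'cV[R]_n -> R)
    (K : R) (m : 'cV[R]_n) (A : 'M[R]_n) :
  measurable_fun setT f -> sym_posdef A ->
  (forall x, K + quad_form A (x - m) / 2 <= f x) ->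
  0 < gibbs_const f /\ (\int[lebesgue_cV n]_x (gibbs_density f x)%:E = 1)%E.
Proof.
move=> mf Apos Kf.
have mef : measurable_fun setT (fun x => (expR (- f x))%:E).
  by apply/measurable_EFinP; apply: measurableT_comp => //; exact: measurable_funN.
have mg := @measurable_expR_quad_form _ _ A m.
have [dA IG] := gauss_integral m Apos.
have ef0 x : (0 <= (expR (- f x))%:E)%E by rewrite lee_fin expR_ge0.
have Zfin : (\int[lebesgue_cV n]_x (expR (- f x))%:E)%E \is a fin_num.
  rewrite ge0_fin_numE; last exact: integral_ge0.
  apply: (@le_lt_trans _ _ (\int[lebesgue_cV n]_x
      ((expR (- K))%:E * (expR (- (quad_form A (x - m) / 2)))%:E))%E).
    apply: ge0_le_integral => //.
    - by apply: emeasurable_funM => //; exact/measurable_EFinP.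
    - move=> x _; rewrite -EFinM -expRD lee_fin ler_expR.
      by have := Kf x; lra.
  rewrite ge0_integralZl//; last exact/measurable_EFinP.
  by rewrite IG -EFinM ltry.
have Z0 : 0 < gibbs_const f.
  rewrite lt_neqAle fine_ge0 ?andbT; last exact: integral_ge0.
  apply/eqP => /esym; rewrite /gibbs_const /Rintegral => fZ0.
  have Z0 : (\int[lebesgue_cV n]_x (expR (- f x))%:E = 0)%E.
    by rewrite -(fineK Zfin) fZ0.
  have [N [mN muN0 subN]] : ae_eq (lebesgue_cV n) setT
      (fun x => (expR (- f x))%:E) (cst 0%E).
    apply/ae_eq_integral_abs => //; rewrite -[RHS]Z0.
    by apply: eq_integral => x _; rewrite gee0_abs.
  have NT : N = setT.
    apply/seteqP; split => // x _; apply: subN => /= /(_ Logic.I) [] /eqP.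
    by rewrite gt_eqF// expR_gt0.
  have : (\int[lebesgue_cV n]_(x in N)
      (expR (- (quad_form A (x - m) / 2)))%:E = 0)%E.
    apply: null_set_integral => //.
    by rewrite NT; exact/measurable_EFinP.
  rewrite NT IG => -[] /eqP; rewrite gt_eqF// mulr_gt0// powR_gt0//.
  by rewrite mulr_gt0// pi_gt0.
split=> //; rewrite /gibbs_density; under eq_integral do rewrite EFinM.
rewrite ge0_integralZl//; last by rewrite lee_fin invr_ge0 ltW.
by rewrite -(fineK Zfin) -EFinM mulVf// gt_eqF.
Qed.

(* The constant [e] is the value at [x], where it is smallest, of the ratio of the
   Gaussian density to the Gibbs density. *)
Lemma normal_density_ge_gibbs_density {R : realType} {n : nat} (f : 'cV[R]_n -> R)
    (S : 'M[R]_n) (x g : 'cV[R]_n) (e : R) :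
  sym_posdef S ->
  convex_function (E := 'cV[R]_n) setT (fun y => f y - quad_form (invmx S) y / 2) ->
  is_subgradient f x g ->
  e = (2 * pi) `^ (- (n%:R / 2)) * \det S `^ (- (1 / 2)) * gibbs_const f
      * expR (f x - quad_form S g / 2) ->
  [/\ measurable_fun setT f, 0 < gibbs_const f,
      (\int[lebesgue_cV n]_y (gibbs_density f y)%:E = 1)%E,
      forall y, e * gibbs_density f y <= normal_density (x - S *m g) S y &
      e * gibbs_density f x = normal_density (x - S *m g) S x].
Proof.
move=> Spos cvxf gf eE; have Apos := sym_posdef_invmx Spos.
have mf : measurable_fun setT f.
  rewrite (_ : f = fun y => (f y - quad_form (invmx S) y / 2)
                          + quad_form (invmx S) (y - 0) / 2).
    apply: measurable_funD; first exact: convex_measurable.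
    apply: measurable_funM; [exact: measurable_quad_form|exact: measurable_cst].
  by apply/funext => y; rewrite subr0 subrK.
have squareE y : quad_form (invmx S) (y - (x - S *m g)) =
    quad_form (invmx S) (y - x) + 2 * (g^T *m (y - x)) 0 0 + quad_form S g.
  have -> : y - (x - S *m g) = y - x + S *m g by rewrite opprB addrA addrAC.
  exact: quad_form_complete_square.
have Kf y : f x - quad_form S g / 2
    + quad_form (invmx S) (y - (x - S *m g)) / 2 <= f y.
  have := strongly_convex_subgradient cvxf gf y; rewrite squareE; lra.
have Kfx : f x - quad_form S g / 2
    + quad_form (invmx S) (x - (x - S *m g)) / 2 = f x.
  have q0 : quad_form (invmx S) 0 = 0 by rewrite /quad_form mulmx0 mxE.
  rewrite squareE subrr q0 mulmx0 mxE; lra.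
have [Z0 int1] := integral_gibbs_density mf Apos Kf.
have ratioE y : e * gibbs_density f y = normal_density (x - S *m g) S y *
    expR (f x - quad_form S g / 2
          + quad_form (invmx S) (y - (x - S *m g)) / 2 - f y).
  rewrite eE /gibbs_density /normal_density -[RHS]mulrA -expRD.
  rewrite (_ : - _ + _ = (f x - quad_form S g / 2) + - f y); last by ring.
  by rewrite [expR (_ + - f y)]expRD; field; rewrite gt_eqF.
have N0 y : 0 <= normal_density (x - S *m g) S y.
  by rewrite /normal_density !mulr_ge0 ?powR_ge0 ?expR_ge0.
split=> // [y|]; rewrite ratioE; last by rewrite Kfx subrr expR0 mulr1.
by rewrite ler_piMr// expR_le1 subr_le0; exact: Kf.
Qed.

Lemma mhi_accept_minimizer {R : realType} {n : nat} (p q : 'cV[R]_n -> R)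
    (e : R) (x y : 'cV[R]_n) :
  0 < p x -> 0 < q y -> e * p y <= q y -> e * p x = q x ->
  mhi_accept p q x y * q y = e * p y.
Proof.
move=> px0 qy0 epq epx; rewrite /mhi_accept -epx.
have -> : p y * (e * p x) / (p x * q y) = e * p y / q y.
  by field; rewrite !gt_eqF.
rewrite (min_idPl _) ?divfK ?gt_eqF//.
by rewrite ler_pdivrMr// mul1r.
Qed.

Theorem proposition3 (R : realType) (d : nat) (f : 'cV[R]_d -> R)
    (alpha : R) (C : 'M[R]_d) (theta0 g : 'cV[R]_d)
    (target := gibbs_density f)
    (proposal := normal_density (theta0 - alpha^-1 *: (C *m g)) (alpha^-1 *: C))
    (Pi := density_measure target)
    (Q := density_measure proposal)
    (P := mhi_kernel target proposal)
    (eps := (2 * pi) `^ (- (d%:R / 2)) * \det (alpha^-1 *: C) `^ (- (1 / 2))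
            * gibbs_const f
            * expR (f theta0 - 1 / (2 * alpha) * quad_form C g)) :
  0 < alpha ->
  sym_posdef C ->
  convex_function (E := 'cV[R]_d) setT
    (fun theta => f theta - alpha * quad_form (invmx C) theta / 2) ->
  is_subgradient f theta0 g ->
  (exists2 B, measurable B & Q B <> Pi B) ->
  forall rho : 'cV[R]_d -> 'cV[R]_d -> R,
    is_metric rho ->
    lower_semicontinuous
      (fun p : 'cV[R]_d * 'cV[R]_d => (rho p.1 p.2)%:E) ->
  forall t : nat, (1 <= t)%N ->
    wasserstein rho (kernel_iter P t theta0) Pi
    = (((1 - eps) ^+ t)%:E * \int[Pi]_theta (rho theta theta0)%:E)%E.
Proof.
move=> alpha0 Cpos cvxf gf _ rho rho_metric rho_lsc t _.
have Spos : sym_posdef (alpha^-1 *: C).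
  by apply: sym_posdefZ Cpos; rewrite invr_gt0.
have quadSE : quad_form (alpha^-1 *: C) g = alpha^-1 * quad_form C g.
  by rewrite /quad_form -scalemxAr -scalemxAl mxE.
have quadVE x : quad_form (invmx (alpha^-1 *: C)) x = alpha * quad_form (invmx C) x.
  rewrite invmxZ ?(sym_posdef_unitmx Spos)// invrK.
  by rewrite /quad_form -scalemxAr -scalemxAl mxE.
have cvxS : convex_function (E := 'cV[R]_d) setT
    (fun y => f y - quad_form (invmx (alpha^-1 *: C)) y / 2).
  by move: cvxf; under eq_fun do rewrite -quadVE.
have epsE : eps = (2 * pi) `^ (- (d%:R / 2)) * \det (alpha^-1 *: C) `^ (- (1 / 2))
    * gibbs_const f * expR (f theta0 - quad_form (alpha^-1 *: C) g / 2).
  rewrite /eps quadSE; congr (_ * expR (_ - _)).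
  by field; rewrite gt_eqF.
have proposalE : proposal =
    normal_density (theta0 - (alpha^-1 *: C) *m g) (alpha^-1 *: C).
  by rewrite /proposal -scalemxAl.
have [mf Z0 target1 eps_le eps_eq] :=
  normal_density_ge_gibbs_density Spos cvxS gf epsE.
rewrite -proposalE -/target in eps_le eps_eq target1.
have eps0 : 0 < eps.
  have [detS _] := gauss_integral 0 Spos.
  rewrite epsE; apply: mulr_gt0 (expR_gt0 _); apply: mulr_gt0 Z0.
  apply: mulr_gt0; apply: powR_gt0; last exact: detS.
  exact: mulr_gt0 (pi_gt0 _).
have target_gt0 x : 0 < target x by rewrite mulr_gt0 ?invr_gt0 ?expR_gt0.
have proposal_gt0 x : 0 < proposal x.
  by apply: lt_le_trans (eps_le x); rewrite mulr_gt0.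
have mtarget : measurable_fun setT target := measurable_gibbs_density mf.
have mproposal : measurable_fun setT proposal := measurable_normal_density _ _.
have proposal1 : (\int[lebesgue_cV d]_x (proposal x)%:E = 1)%E.
  by rewrite proposalE integral_normal_density.
clearbody target proposal eps.
have eps01 : 0 <= eps <= 1.
  rewrite ltW//= -lee_fin -proposal1 -[eps%:E]mule1 -target1.
  rewrite -ge0_integralZl//; last 3 first.
  - exact/measurable_EFinP.
  - by move=> x _; rewrite lee_fin ltW.
  - by rewrite lee_fin ltW.
  apply: ge0_le_integral => //.
  - by move=> x _; rewrite -EFinM lee_fin mulr_ge0// ltW.
  - by apply: emeasurable_funM => //; exact/measurable_EFinP.
  - exact/measurable_EFinP.
  - by move=> x _; rewrite -EFinM lee_fin.
have acceptE y : mhi_accept target proposal theta0 y * proposal y = eps * target y.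
  exact: mhi_accept_minimizer.
have [nu nuE] := density_is_measure (lebesgue_cV d) mtarget (fun x => ltW (target_gt0 x)).
have PiE : Pi = nu by apply/funext => B; rewrite nuE.
rewrite PiE; apply: wasserstein_mixture => //.
- exact: lower_semicontinuous_measurable_pair rho_lsc.
- by rewrite nuE.
- by case/andP: eps01 => e0 e1; rewrite exprn_ge0 ?exprn_ile1//; lra.
- move=> B mB; rewrite (kernel_iter_mhi_minimizer _ _ _ _ _ _ _ eps01)// ?proposal1//.
  by rewrite -/Pi PiE.
Qed.
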